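(* Let $d\ge2$, $R>0$ and let $A\subset\mathbb{R}^d$ be a body. The following are equivalent: (i) $A$ is an $R$-supported body and $\mathrm{Nor}(A,a)\cap S^{d-1}=\mathcal{N}_R(A,a)$ for every $a\in\partial A$; (ii) $\mathrm{reach}(A)\ge R$.
   Context: A body is a nonempty closed subset of $\mathbb{R}^d$; $S^{d-1}$ is the unit sphere; $B(x)=\{y:|y-x|<R\}$. For $a\in\partial A$, $\mathcal{N}_R(A,a)=\{v\in S^{d-1}: A\cap B(a+Rv)=\emptyset\}$; $A$ is $R$-supported if $\mathcal{N}_R(A,a)\ne\emptyset$ for all $a\in\partial A$. Tangent cone: $\mathrm{Tan}(A,q)=\{v: \forall\varepsilon>0\ \exists x\in A,\ |x-q|<\varepsilon,\ \exists r>0,\ |r(x-q)-v|<\varepsilon\}$; normal cone: $\mathrm{Nor}(A,q)=\{u:\langle u,v\rangle\le0\ \forall v\in\mathrm{Tan}(A,q)\}$. $\mathrm{Unp}(A)$ is the set of points with a unique nearest point in $A$; $\mathrm{reach}(A,a)=\sup\{\rho>0: \{x:|x-a|<\rho\}\subset\mathrm{Unp}(A)\}$, $\mathrm{reach}(A)=\inf_{a\in A}\mathrm{reach}(A,a)$. *)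

(* Defs.v *)
From HB Require Import structures.
From mathcomp Require Import all_boot all_order all_algebra.
From mathcomp Require Import boolp classical_sets reals constructive_ereal ereal.
Set Implicit Arguments. Unset Strict Implicit. Unset Printing Implicit Defensive.
Import Order.TTheory GRing.Theory Num.Theory.
Local Open Scope classical_set_scope.
Local Open Scope ring_scope.

Section Defs.
Variables (R : realType) (d : nat).
Notation V := 'rV[R]_d.

Definition dotE (u v : V) : R := \sum_(i < d) u 0 i * v 0 i.
Definition enorm (u : V) : R := Num.sqrt (dotE u u).

Definition eball (x : V) (r : R) : set V := [set y | enorm (y - x) < r].

Definition sphere : set V := [set v | enorm v = 1].

Definition eclosed (A : set V) : Prop :=
  forall x : V, (forall e : R, 0 < e -> eball x e `&` A !=set0) -> A x.
Definition boundary (A : set V) : set V :=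
  [set x | forall e : R, 0 < e -> eball x e `&` A !=set0 /\ eball x e `&` ~` A !=set0].

Definition body (A : set V) : Prop := A !=set0 /\ eclosed A.

Definition NR (A : set V) (r : R) (a : V) : set V :=
  [set v | sphere v /\ A `&` eball (a + r *: v) r = set0].

Definition R_supported (A : set V) (r : R) : Prop :=
  forall a, boundary A a -> NR A r a !=set0.

Definition Tan (A : set V) (q : V) : set V :=
  [set v | forall e : R, 0 < e -> exists x, A x /\ enorm (x - q) < e /\
     exists t : R, 0 < t /\ enorm (t *: (x - q) - v) < e].
Definition Nor (A : set V) (q : V) : set V :=
  [set u | forall v, Tan A q v -> dotE u v <= 0].

Definition is_nearest (A : set V) (x a : V) : Prop :=
  A a /\ forall b, A b -> enorm (x - a) <= enorm (x - b).
Definition Unp (A : set V) : set V :=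
  [set x | exists a, is_nearest A x a /\ forall b, is_nearest A x b -> b = a].

(* reach, as extended reals (sup of the empty set is -oo) *)
Definition reach_at (A : set V) (a : V) : \bar R :=
  ereal_sup [set (rho%:E)%E | rho in [set rho : R | 0 < rho /\ eball a rho `<=` Unp A]].
Definition reach (A : set V) : \bar R :=
  ereal_inf [set reach_at A a | a in A].

End Defs.

(* Main.v *)
(* (i) => (ii): if a point x at distance delta < r from A had two nearest points
   a and b, then the unit vector from a to x is normal to A at a, so the ball of
   radius r touching A at a in this direction misses A; but it contains the
   closed ball of radius delta about x except for a, hence also b.
   (ii) => (i): nearest points are unique, hence depend continuously on the
   point, and so the distance to A grows with slope 1 along outward directions.
   An extremal argument turns this into: the outward ray through x keeps the same
   nearest point a up to distance r, so the ball of radius r touching A at a in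
   this direction misses A. Touching balls of radius r pass to the limit; for a
   boundary point a one approximates a by points outside A, and for a unit normal
   u at a one uses the outward directions at a + t u, which tend to u as t -> 0. *)
Require Import Defs.
From HB Require Import structures.
From mathcomp Require Import all_boot all_order all_algebra.
From mathcomp Require Import ring lra.
From mathcomp Require Import boolp classical_sets reals constructive_ereal ereal.
From mathcomp Require Import filter topology normedtype.
Import Order.TTheory GRing.Theory Num.Theory. 
Import numFieldNormedType.Exports.
Local Open Scope classical_set_scope.
Local Open Scope ring_scope.

(** * Euclidean norm, comparison with the sup norm, compactness *)

Section Euclidean.
Set Implicit Arguments.
Unset Strict Implicit.
Variables (R : realType) (d : nat).
Notation V := 'rV[R]_d.
Implicit Types (u v w x y : V) (A : set V).

Lemma dotC u v : dotE u v = dotE v u.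
Proof. by apply: eq_bigr => i _; rewrite mulrC. Qed.

Lemma dotDl u v w : dotE (u + v) w = dotE u w + dotE v w.
Proof. by rewrite -big_split; apply: eq_bigr => i _; rewrite mxE mulrDl. Qed.

Lemma dotZl c u v : dotE (c *: u) v = c * dotE u v.
Proof. by rewrite /dotE mulr_sumr; apply: eq_bigr => i _; rewrite mxE mulrA. Qed.

Lemma dotNl u v : dotE (- u) v = - dotE u v.
Proof. by rewrite -scaleN1r dotZl mulN1r. Qed.

Lemma dotDr u v w : dotE w (u + v) = dotE w u + dotE w v.
Proof. by rewrite ![dotE w _]dotC dotDl. Qed.

Lemma dotZr c u v : dotE u (c *: v) = c * dotE u v.
Proof. by rewrite ![dotE u _]dotC dotZl. Qed.

Lemma dotNr u v : dotE u (- v) = - dotE u v.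
Proof. by rewrite ![dotE u _]dotC dotNl. Qed.

Definition dot_linE := (dotDl, dotDr, dotNl, dotNr, dotZl, dotZr).

Lemma dot_ge0 u : 0 <= dotE u u.
Proof. by apply: sumr_ge0 => i _; rewrite -expr2 sqr_ge0. Qed.

Lemma enorm_ge0 u : 0 <= enorm u.
Proof. exact: sqrtr_ge0. Qed.
#[local] Hint Resolve enorm_ge0 : core.

Lemma le_of_sqr (s t : R) : 0 <= t -> s ^+ 2 <= t ^+ 2 -> s <= t.
Proof. by move=> t0 st; rewrite leNgt; apply/negP => ts; nra. Qed.

Lemma sqr_homo (s t : R) : 0 <= s -> s <= t -> s ^+ 2 <= t ^+ 2.
Proof. by move=> s0 st; nra. Qed.

Lemma enorm_sqr u : enorm u ^+ 2 = dotE u u.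
Proof. by rewrite sqr_sqrtr// dot_ge0. Qed.

Lemma enorm0 : enorm (0 : V) = 0.
Proof. by rewrite /enorm -(scale0r (0 : V)) dotZl mul0r sqrtr0. Qed.

Lemma enorm_eq0 u : enorm u = 0 -> u = 0.
Proof.
move=> u0; have /eqP : dotE u u = 0 by rewrite -enorm_sqr u0 expr0n.
rewrite psumr_eq0 => [/allP h|i _]; last by rewrite -expr2 sqr_ge0.
apply/rowP => i; rewrite mxE; have := h i (mem_index_enum i).
by rewrite /= mulf_eq0 orbb => /eqP.
Qed.

Lemma enorm_gt0 u : u <> 0 -> 0 < enorm u.
Proof. by move=> u0; rewrite lt_def enorm_ge0 andbT; apply/eqP => /enorm_eq0. Qed.

Lemma enormZ c u : enorm (c *: u) = `|c| * enorm u.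
Proof. by rewrite /enorm dotZl dotZr mulrA -expr2 sqrtrM ?sqr_ge0// sqrtr_sqr. Qed.

Lemma enormN u : enorm (- u) = enorm u.
Proof. by rewrite -scaleN1r enormZ normrN1 mul1r. Qed.

Lemma enormB u v : enorm (u - v) = enorm (v - u).
Proof. by rewrite -enormN opprB. Qed.

Lemma enormD_sqr u v :
  enorm (u + v) ^+ 2 = enorm u ^+ 2 + 2 * dotE u v + enorm v ^+ 2.
Proof. by rewrite !enorm_sqr !dot_linE (dotC v u); ring. Qed.

Lemma cauchy_schwarz u v : dotE u v <= enorm u * enorm v.
Proof.
have := dot_ge0 (enorm v *: u - enorm u *: v).
rewrite !dot_linE (dotC v u) -!enorm_sqr.
have [/enorm_eq0 ->|u0] := eqVneq (enorm u) 0.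
  by move=> _; rewrite enorm0 mul0r -(scale0r (0 : V)) dotZl mul0r.
have [/enorm_eq0 ->|v0] := eqVneq (enorm v) 0.
  by move=> _; rewrite enorm0 mulr0 -(scale0r (0 : V)) dotZr mul0r.
have p : 0 < enorm u * enorm v by rewrite mulr_gt0// lt_def enorm_ge0 andbT.
move=> h; rewrite -subr_ge0 -(pmulr_rge0 _ p).
by nra.
Qed.

Lemma enormD u v : enorm (u + v) <= enorm u + enorm v.
Proof.
apply: le_of_sqr; first by rewrite addr_ge0.
by rewrite enormD_sqr; have := cauchy_schwarz u v; nra.
Qed.

Lemma enorm_triangle x y z : enorm (x - z) <= enorm (x - y) + enorm (y - z).
Proof. by rewrite -(subrKA y x (- z)) enormD. Qed.

(** The topology on row vectors comes from the sup norm; this bound and the next transfer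
    compactness to the Euclidean norm. *)
Lemma mx_norm_le_enorm u : `|u| <= enorm u.
Proof.
rewrite [leLHS]/Num.Def.normr /= mx_normrE; apply/bigmax_leP; split => // -[i j] _ /=.
rewrite (ord1 i) -(ler_sqr (x := `|u 0 j|)) ?nnegrE//.
rewrite enorm_sqr real_normK ?num_real// /dotE (bigD1 j)//= -expr2 lerDl.
by apply: sumr_ge0 => k _; rewrite -expr2 sqr_ge0.
Qed.

Lemma enorm_le_mx_norm u : enorm u <= (d.+1)%:R * `|u|.
Proof.
apply: le_of_sqr; first by rewrite mulr_ge0.
rewrite enorm_sqr; apply: (@le_trans _ _ (\sum_(i < d) `|u| ^+ 2)).
  apply: ler_sum => i _; rewrite -expr2 -real_normK ?num_real// ler_sqr ?nnegrE//.
  by rewrite [leRHS]/Num.Def.normr /= mx_normrE; apply/bigmax_geP; right; exists (0, i).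
rewrite sumr_const card_ord -[leLHS]mulr_natl exprMn ler_wpM2r ?sqr_ge0// -natrX ler_nat.
by rewrite (leq_trans (leqnSn d))// leq_pmulr.
Qed.

(* Sequential compactness, with the sequence replaced by a property that
   becomes stronger as its parameter decreases to 0. *)
Lemma shrinking_limit (P : R -> V -> Prop) (M : R) :
  (forall e e' v, e <= e' -> P e v -> P e' v) ->
  (forall e, 0 < e -> exists v, P e v /\ enorm v <= M) ->
  exists l, forall e, 0 < e -> exists v, P e v /\ enorm (v - l) < e.
Proof.
move=> mP exP.
pose S e := [set v | P e v /\ enorm v <= M].
pose F := filter_from [set e : R | 0 < e] S.
have FF : ProperFilter F.
  apply: filter_from_proper; last by move=> e /exP.
  apply: filter_from_filter; first by exists 1 => /=.
  move=> e e' /= e0 e'0; exists (Num.min e e'); first by rewrite /= lt_min e0.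
  by move=> v [Pv vM]; split; split=> //; apply: mP Pv; rewrite ge_min lexx ?orbT.
have cK : compact [set v : V | `|v| <= M].
  apply: bounded_closed_compact.
    exists M; split; first exact: num_real.
    by move=> N MN v /= vM; rewrite (le_trans vM)// ltW.
  rewrite (_ : mkset _ = (@Num.Def.normr _ V) @^-1` [set t | t <= M])//.
  by apply: closed_comp (@closed_le _ M) => v _; exact: norm_continuous.
have [|l [_ cl]] := cK F FF.
  by exists 1 => //= v [_ vM]; exact: le_trans (mx_norm_le_enorm v) vM.
exists l => e e0; pose n : R := (d.+1)%:R.
have n0 : 0 < n by rewrite ltr0n.
have [v [[Pv _] lv]] := cl (S e) (ball l (e / n))
  (ex_intro2 _ _ e e0 (fun v h => h)) (nbhsx_ballx _ _ (divr_gt0 e0 n0)).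
exists v; split => //; apply: le_lt_trans (enorm_le_mx_norm _) _.
by move: lv; rewrite -ball_normE /= distrC ltr_pdivlMr// mulrC.
Qed.

(** Near-minimisers accumulate at a point of the closed bounded set, and the Lipschitz bound carries
    the infimum to it. *)
Lemma lipschitz_min (f : V -> R) (L M : R) (K : set V) :
  eclosed K -> K !=set0 -> (forall v, K v -> enorm v <= M) -> 0 <= L ->
  (forall x y, f x <= f y + L * enorm (x - y)) ->
  exists2 l, K l & forall v, K v -> f l <= f v.
Proof.
move=> cK [v0 Kv0] bK L0 fL.
have hinf : has_inf [set f v | v in K].
  split; first by exists (f v0), v0.
  exists (f v0 - L * (M + M)) => _ [v Kv <-]; rewrite lerBlDr.
  apply: le_trans (fL v0 v) _; rewrite lerD2l ler_wpM2l//.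
  by rewrite (le_trans (enormD _ _))// enormN lerD// bK.
have [e e' v ee' [Kv fv]||l hl] := @shrinking_limit
    (fun e v => K v /\ f v < inf [set f v | v in K] + e) M.
- by split => //; apply: lt_le_trans fv _; rewrite lerD2l.
- move=> e e0; have [_ [v Kv <-] fv] := inf_adherent e0 hinf.
  by exists v; split => //; exact: bK.
have Kl : K l by apply: cK => e /hl [v [[Kv _] vl]]; exists v; split.
exists l => // v Kv; apply: le_trans (_ : inf [set f v | v in K] <= _).
  apply/ler_addgt0Pr => e e0.
  have p : 0 < e / (L + 1) by rewrite divr_gt0//; lra.
  have [w [[Kw fw] wl]] := hl _ p.
  have := fL l w; rewrite enormB.
  have -> : e = e / (L + 1) + L * (e / (L + 1)) by field; lra.
  have := ler_wpM2l L0 (ltW wl); lra.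
by apply: ge_inf; [case: hinf | exists v].
Qed.

End Euclidean.

(** * Existence of nearest points *)

Section NearestExists.
Set Implicit Arguments.
Unset Strict Implicit.
Variables (R : realType) (d : nat).
Notation V := 'rV[R]_d.
Implicit Types (A : set V) (a b u v w x y z : V).
#[local] Hint Resolve enorm_ge0 : core.
#[local] Opaque enorm dotE.

(** Only points of [A] no farther than a fixed [a0] compete, and these form a closed bounded set. *)
Lemma nearest_exists A x : body A -> exists a, is_nearest A x a.
Proof.
move=> -[[a0 Aa0] cA].
pose K := A `&` [set v : V | enorm (x - v) <= enorm (x - a0)].
have [||v [_ Kv]|||a [Aa Ka] amin] :=
    @lipschitz_min _ _ (fun v : V => enorm (x - v)) 1 (enorm x + enorm (x - a0)) K.
- move=> v hv; split; first by apply: cA => e /hv [k [kv [Ak _]]]; exists k.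
  apply/ler_addgt0Pr => e /hv [k [kv [_ Kk]]].
  by apply: le_trans (enorm_triangle x k v) _; rewrite lerD// ltW.
- by exists a0; split => //=.
- have := enorm_triangle v x 0; rewrite !subr0 enormB.
  by move: Kv => /= ; lra.
- exact: ler01.
- move=> y z; have := enorm_triangle x z y; rewrite (enormB y z).
  by rewrite mul1r.
exists a; split => // b Ab.
have [ba|/ltW] := leP (enorm (x - b)) (enorm (x - a0)); first exact: amin.
exact: le_trans.
Qed.

End NearestExists.

(** * Projection and distance: stability and local growth *)

Section NearestPoint.
Set Implicit Arguments.
Unset Strict Implicit.
Variables (R : realType) (d : nat) (A : set 'rV[R]_d).
Hypothesis bA : body A.
Notation V := 'rV[R]_d.
Implicit Types (a b u v w x y z : V) (r s t c e : R).
#[local] Hint Resolve enorm_ge0 : core.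
#[local] Opaque enorm dotE.

(** A choice among the nearest points; a body always has one, so the default 0 never arises from a
    failed choice. *)
Definition proj x : V := xget 0 (is_nearest A x).
(* [locked] keeps unification from unfolding norms. *)
Definition dist x : R := locked (enorm (x - proj x)).

Lemma distE x : dist x = enorm (x - proj x).
Proof. by rewrite /dist -lock. Qed.

Lemma proj_nearest x : is_nearest A x (proj x).
Proof. exact: xgetPex (nearest_exists x bA). Qed.

Lemma dist_le x b : A b -> dist x <= enorm (x - b).
Proof. by rewrite distE; have [_] := proj_nearest x; apply. Qed.

Lemma dist_ge0 x : 0 <= dist x.
Proof. by rewrite distE. Qed.

Lemma nearest_dist x a : is_nearest A x a -> enorm (x - a) = dist x.
Proof.
move=> [Aa amin]; apply: le_anti; rewrite dist_le// distE amin//.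
by case: (proj_nearest x).
Qed.

Lemma le_dist x c : (forall b, A b -> c <= enorm (x - b)) -> c <= dist x.
Proof. by rewrite distE; apply; case: (proj_nearest x). Qed.

Lemma dist_lip x y : dist x <= dist y + enorm (x - y).
Proof.
have [Ap _] := proj_nearest y; apply: le_trans (dist_le x Ap) _.
rewrite [leRHS]addrC (distE y); exact: enorm_triangle.
Qed.

(** Points of [A] at least [e] away from the unique nearest point form a closed set, strictly
    farther from [y]; half the gap serves as [h]. *)
Lemma nearest_stable y e : Unp A y -> 0 < e ->
  exists2 h, 0 < h & forall z b, enorm (z - y) < h -> is_nearest A z b ->
    enorm (b - proj y) < e.
Proof.
move=> [p [np up]] e0; rewrite (up _ (proj_nearest y)).
pose K := A `&` [set b : V | e <= enorm (b - p)].
have [K0|/set0P K0] := eqVneq K set0.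
  exists 1 => [|z b _ [Ab _]]; first exact: ltr01.
  rewrite ltNge; apply/negP => eb.
  have : K b by [].
  by rewrite K0.
have cK : eclosed K.
  move=> v hv; split; first by apply: (bA.2) => t /hv [k [kv [Ak _]]]; exists k.
  apply/ler_addgt0Pr => t /hv [k [/ltW kv [_ /= Kk]]]; apply: le_trans Kk _.
  by apply: le_trans (enorm_triangle k v p) _; rewrite addrC lerD2l.
have [q [[Aq /= eq] qmin]] := nearest_exists y (conj K0 cK).
have lt_pq : enorm (y - p) < enorm (y - q).
  rewrite ltNge; apply/negP => le_qp.
  have qp : q = p by apply: up; split => // b /np.2; exact: le_trans.
  by move: eq; rewrite qp subrr enorm0; lra.
exists ((enorm (y - q) - enorm (y - p)) / 2) => [|z b zy [Ab bmin]].
  by rewrite divr_gt0// subr_gt0.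
rewrite ltNge; apply/negP => eb.
have := qmin b (conj Ab eb).
have := enorm_triangle y z b; have := enorm_triangle z y p.
have := bmin _ np.1; rewrite (enormB y z); lra.
Qed.

(** A short step along the unit vector from [proj y] to [y] barely moves the nearest point, so the
    distance grows at nearly unit rate. *)
Lemma dist_ascent y c e : Unp A y -> 0 < dist y -> 0 <= c -> c < 1 -> 0 < e ->
  exists2 z : V, 0 < enorm (z - y) < e & dist y + c * enorm (z - y) <= dist z.
Proof.
move=> uy + c0 c1 e0; set p := proj y.
have [D DE] : exists D, dist y = D by exists (dist y).
rewrite !DE => D0; have yp : enorm (y - p) = D by rewrite -distE.
pose w := D^-1 *: (y - p).
have w1 : enorm w = 1.
  by rewrite enormZ yp gtr0_norm ?invr_gt0// mulVf// gt_eqF.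
have wyp : dotE w (y - p) = D.
  by rewrite dotZl -enorm_sqr yp; field; rewrite gt_eqF.
(* If [b] is within [(1 - c) * D] of [p], then [dotE (y - b) w] is still at least [c * D]. *)
have eps0 : 0 < (1 - c) * D by rewrite mulr_gt0// subr_gt0.
have [h h0 hproj] := nearest_stable uy eps0.
have [t t0 [th te]] : exists2 t, 0 < t & t < h /\ t < e.
  exists (Num.min h e / 2); first by rewrite divr_gt0// lt_min h0.
  have : Num.min h e <= h by rewrite ge_min lexx.
  have : Num.min h e <= e by rewrite ge_min lexx orbT.
  have : 0 < Num.min h e by rewrite lt_min h0.
  lra.
have zy : enorm (y + t *: w - y) = t.
  by rewrite addrAC subrr add0r enormZ w1 mulr1 gtr0_norm.
exists (y + t *: w); first by rewrite zy t0 te.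
have := hproj (y + t *: w) _ _ (proj_nearest _); rewrite zy => /(_ th).
have [] := proj_nearest (y + t *: w); rewrite distE.
set b := proj _ => Ab _ pb.
have -> : y + t *: w - b = (y - b) + t *: w by rewrite addrAC.
apply: le_of_sqr => //; rewrite enormD_sqr enormZ w1 mulr1 gtr0_norm// dotZr.
have yb : D ^+ 2 <= enorm (y - b) ^+ 2.
  by apply: sqr_homo; [exact: ltW | rewrite -DE; exact: dist_le].
have hq : c * D <= dotE (y - b) w.
  have -> : y - b = (y - p) - (b - p) by rewrite opprB addrA subrK.
  rewrite dotDl dotNl (dotC (y - p)) wyp.
  have := le_lt_trans (cauchy_schwarz (b - p) w); rewrite w1 mulr1.
  by move=> /(_ _ pb); clear; move: (dotE _ w) => q; lra.
have tq := ler_wpM2l (ltW t0) hq.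
(* Weakening [t ^+ 2] to [c ^+ 2 * t ^+ 2] completes the square [(D + c * t) ^+ 2]. *)
have : c ^+ 2 * t ^+ 2 <= t ^+ 2 by rewrite ler_piMl ?sqr_ge0// expr_le1// ltW.
move: yb tq; rewrite sqrrD exprMn -mulr_natl; clear.
by move: (dotE _ w) (enorm _ ^+ 2) => q Y; lra.
Qed.

End NearestPoint.

Local Ltac norm_lra :=
  clear; repeat match goal with
    | |- context [@enorm ?R ?d ?u] => generalize (@enorm R d u)
    | |- context [@dotE ?R ?d ?u ?v] => generalize (@dotE R d u v)
    | |- context [@dist ?R ?d ?A ?u] => generalize (@dist R d A u)
  end; repeat (let h := fresh "hyp" in intro h); lra.

(** * Touching balls, normal vectors and unique projection *)

Section Reach.
Set Implicit Arguments.
Unset Strict Implicit.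
Variables (R : realType) (d : nat) (A : set 'rV[R]_d).
Hypothesis bA : body A.
Notation V := 'rV[R]_d.
#[local] Opaque enorm dotE proj.
Notation dist := (dist A).
Notation proj := (proj A).
Implicit Types (a b u v w x y z : V) (r s t c e : R).

Definition outward x : V := (dist x)^-1 *: (x - proj x).

Lemma outward_sphere x : 0 < dist x -> enorm (outward x) = 1.
Proof.
by move=> D0; rewrite /outward enormZ gtr0_norm ?invr_gt0// -distE mulVf// gt_eqF.
Qed.

Lemma outwardE x : 0 < dist x -> dist x *: outward x = x - proj x.
Proof. by move=> D0; rewrite scalerA divff ?gt_eqF// scale1r. Qed.

Lemma dist_gt0 x : ~ A x -> 0 < dist x.
Proof.
move=> nAx; rewrite distE; apply: enorm_gt0 => /subr0_eq xp; apply: nAx.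
by rewrite xp; case: (proj_nearest bA x).
Qed.

(** As an inequality on the Lipschitz function [dist], the touching-ball condition passes to
    limits. *)
Lemma NRE r a v : NR A r a v <-> enorm v = 1 /\ r <= dist (a + r *: v).
Proof.
split=> [] [v1 h]; split=> //.
  apply: (le_dist bA) => b Ab; rewrite leNgt; apply/negP => lt.
  have : (A `&` eball (a + r *: v) r) b by split; rewrite // /eball /= enormB.
  by rewrite h.
rewrite -subset0 => b [Ab]; rewrite /eball /= enormB ltNge.
by rewrite (le_trans h)// dist_le.
Qed.

(** Expand the square of [|r v - (b - a)| >= r], which says that [b] lies outside the touching
    ball. *)
Lemma NR_dot r a v b : 0 < r -> NR A r a v -> A b ->
  2 * r * dotE (b - a) v <= enorm (b - a) ^+ 2.
Proof.
move=> r0 /NRE[v1 h] Ab.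
have := sqr_homo (ltW r0) (le_trans h (dist_le bA _ Ab)).
have -> : a + r *: v - b = r *: v - (b - a) by rewrite opprB addrCA addrA.
rewrite (enormD_sqr (r *: v)) enormN enormZ v1 mulr1 gtr0_norm//.
rewrite dotNr dotZl (dotC v); clear.
by move: (dotE _ v) (enorm _ ^+ 2) => q B; lra.
Qed.

(** By [NR_dot], [dotE (b - a) v] is at most quadratic in [|b - a|], so no limit of directions into
    [A] has positive product with [v]. *)
Lemma NR_Nor r a v : 0 < r -> NR A r a v -> Nor A a v.
Proof.
move=> r0 nv w Tw; rewrite dotC leNgt; apply/negP => c0.
have [v1 _] := (NRE _ _ _).1 nv.
have [c cE] : exists c, dotE w v = c by exists (dotE w v).
(* Approximating [w] costs [e] and the quadratic bound gives [e * (k - 1)]; together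
   [c <= e * k <= c / 2], a contradiction. *)
rewrite cE in c0; pose k := 1 + (enorm w + 1) / (2 * r).
have k0 : 0 < k.
  by rewrite addr_gt0 ?ltr01// divr_gt0 ?mulr_gt0 ?ltr0n// ltr_wpDl ?enorm_ge0.
have ck0 : 0 < c / (2 * k) by rewrite divr_gt0 ?mulr_gt0 ?ltr0n.
have [e [e0 e1 ek]] : exists e, [/\ 0 < e, e <= 1 & e * k <= c / 2].
  exists (Num.min 1 (c / (2 * k))); split.
  - by rewrite lt_min ltr01.
  - by rewrite ge_min lexx.
  - apply: le_trans (_ : c / (2 * k) * k <= _).
      by rewrite ler_wpM2r ?(ltW k0)// ge_min lexx orbT.
    by rewrite le_eqVlt; apply/orP; left; apply/eqP; field; rewrite gt_eqF.
have [b [Ab [ba [t [t0 tw]]]]] := Tw e e0.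
have hb := NR_dot r0 nv Ab.
have cq : c - e <= t * dotE (b - a) v.
  have <- : t * dotE (b - a) v + dotE (w - t *: (b - a)) v = c.
    by rewrite -cE (dotDl w) dotNl dotZl addrC subrK.
  rewrite lerBlDr lerD2l; apply: le_trans (cauchy_schwarz _ _) _.
  by rewrite v1 mulr1 enormB ltW.
have tB : t * enorm (b - a) <= enorm w + 1.
  have <- : enorm (t *: (b - a)) = t * enorm (b - a) by rewrite enormZ gtr0_norm.
  rewrite -(subrK w (t *: (b - a))) addrC; apply: le_trans (enormD _ _) _.
  by rewrite lerD2l (le_trans (ltW tw)).
have tq : 2 * r * (t * dotE (b - a) v) <= (enorm w + 1) * e.
  rewrite mulrCA; apply: le_trans (ler_wpM2l (ltW t0) hb) _.
  by rewrite expr2 mulrA ler_pM ?mulr_ge0 ?enorm_ge0 ?(ltW t0)// ltW.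
rewrite -ler_pdivlMl ?mulr_gt0 ?ltr0n// in tq.
have : (2 * r)^-1 * ((enorm w + 1) * e) = e * k - e by rewrite /k; ring.
move=> E; rewrite {}E in tq; have := le_trans cq tq.
by rewrite lerD2r => /le_trans/(_ ek); clear -c0; lra.
Qed.

(** Moving from [a] a little towards [x] gives points closer to [x] than [a] is, hence outside
    [A]. *)
Lemma nearest_boundary x a : is_nearest A x a -> x <> a -> boundary A a.
Proof.
move=> [Aa amin] xa e e0; split.
  by exists a; split; rewrite // /eball /= subrr enorm0.
have n0 : 0 < enorm (x - a) by apply: enorm_gt0 => /subr0_eq.
pose t := Num.min 1 (e / (2 * enorm (x - a))).
have t0 : 0 < t by rewrite lt_min ltr01 divr_gt0// mulr_gt0.
have t1 : t <= 1 by rewrite ge_min lexx.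
exists (a + t *: (x - a)); split.
  rewrite /eball /= addrAC subrr add0r enormZ gtr0_norm//.
  have : t <= e / (2 * enorm (x - a)) by rewrite ge_min lexx orbT.
  rewrite ler_pdivlMr ?mulr_gt0//; lra.
move=> /amin.
have -> : x - (a + t *: (x - a)) = (1 - t) *: (x - a).
  by rewrite opprD addrA scalerBl scale1r.
rewrite enormZ ger0_norm ?subr_ge0//; nra.
Qed.

Lemma nearest_NR x a : is_nearest A x a -> 0 < enorm (x - a) ->
  NR A (enorm (x - a)) a ((enorm (x - a))^-1 *: (x - a)).
Proof.
move=> na n0; apply/NRE; split.
  by rewrite enormZ gtr0_norm ?invr_gt0// mulVf// gt_eqF.
by rewrite scalerA divff ?gt_eqF// scale1r (addrC a) subrK (nearest_dist bA na).
Qed.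

(** For nearest points [a], [b] at distance [D > 0], equal distances give
    [|b - a|^2 = 2 <b - a, x - a>]; the touching ball of radius [r] then gives
    [(r / D) |b - a|^2 <= |b - a|^2] with [r / D > 1]. *)
Lemma Unp_of_Nor_NR r x : 0 < r ->
  (forall a, boundary A a -> Nor A a `&` sphere (d:=d) `<=` NR A r a) ->
  dist x < r -> Unp A x.
Proof.
move=> r0 hN Dr; exists (proj x); split; first exact: proj_nearest.
move=> b nb; set a := proj x.
have [D0|D0] := eqVneq (dist x) 0.
  have -> : a = x by apply/esym/subr0_eq/enorm_eq0; rewrite -distE.
  by apply/esym/subr0_eq/enorm_eq0; rewrite (nearest_dist bA nb).
have {}D0 : 0 < dist x by rewrite lt_def D0 dist_ge0.
have na := proj_nearest bA x; have Da : enorm (x - a) = dist x by rewrite distE.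
have nv : NR A (dist x) a ((dist x)^-1 *: (x - a)).
  by rewrite -Da; apply: nearest_NR; rewrite ?Da.
have /hN/(_ _)nv' : boundary A a.
  apply: (nearest_boundary na) => xa; move: D0.
  by rewrite -(nearest_dist bA na) -xa subrr enorm0 ltxx.
have /nv' {}nv' := conj (NR_Nor D0 nv) nv.1.
have := NR_dot r0 nv' nb.1; rewrite dotZr.
have := nearest_dist bA nb; move: (dist x) => D in D0 Dr Da nv nv' *.
move=> Db.
have : D ^+ 2 = enorm (b - a) ^+ 2 - 2 * dotE (b - a) (x - a) + D ^+ 2.
  rewrite -{1}Db (_ : x - b = - (b - a) + (x - a)).
    by rewrite (enormD_sqr (- _)) enormN dotNl Da; ring.
  by rewrite opprB [RHS]addrC subrKA.
move=> hq; have qB : 2 * dotE (b - a) (x - a) = enorm (b - a) ^+ 2.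
  by move: hq; clear; move: (dotE _ _) (enorm _ ^+ 2) (D ^+ 2) => q B E; lra.
have -> : 2 * r * (D^-1 * dotE (b - a) (x - a)) =
    (2 * dotE (b - a) (x - a)) * (r / D) by ring.
rewrite qB => hB.
have rD : 1 < r / D by rewrite ltr_pdivlMr// mul1r.
suff : enorm (b - a) ^+ 2 = 0.
  by move/eqP; rewrite expf_eq0 /= => /eqP/enorm_eq0/subr0_eq.
apply: le_anti; rewrite sqr_ge0 andbT -(pmulr_lle0 _ (_ : 0 < r / D - 1)).
  by rewrite mulrBr mulr1 subr_le0.
by rewrite subr_gt0.
Qed.

(** * Growth of the distance along outward rays *)

Section Unp_near.
Variable r : R.
Hypothesis uA : forall x, dist x < r -> Unp A x.

(* Extremal principle: at a maximum of [dist y - c * enorm (y - x)] interior to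
   the ball, [dist_ascent] would give a larger value. *)
Lemma dist_increase x s c : 0 < dist x -> 0 <= s -> dist x + s < r ->
  0 <= c -> c < 1 ->
  exists2 y : V, enorm (y - x) <= s & dist x + c * s <= dist y.
Proof.
move=> D0 s0 Ds c0 c1.
have [||v /= vs||y z|y /= ys ymin] := @lipschitz_min _ _
    (fun y : V => c * enorm (y - x) - dist y) 2 (enorm x + s) [set y : V | enorm (y - x) <= s].
- move=> v hv; apply/ler_addgt0Pr => e /hv [k [/ltW kv /= ks]].
  by apply: le_trans (enorm_triangle v k x) _; rewrite addrC (enormB v) lerD.
- by exists x; rewrite /= subrr enorm0.
- have := enorm_triangle v x 0; rewrite !subr0 => /le_trans; apply.
  by rewrite addrC lerD2l.
- exact: ler0n.
- move: (dist_lip bA z y) (ler_wpM2l c0 (enorm_triangle y z x)).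
  move: (ler_wpM2r (enorm_ge0 (y - z)) (ltW c1)).
  by rewrite (enormB z y); norm_lra.
have := ymin x; rewrite /= subrr enorm0 mulr0 sub0r => /(_ s0) yx.
exists y; first exact: ys.
have [yse|yse] := eqVneq (enorm (y - x)) s.
  by move: yx; rewrite yse; norm_lra.
have {yse}ys : enorm (y - x) < s by rewrite lt_neqAle yse.
have yr : dist y < r by move: (dist_lip bA y x) ys Ds; norm_lra.
have y0 : 0 < dist y.
  by move: (mulr_ge0 c0 (enorm_ge0 (y - x))) yx D0; norm_lra.
(* A slope strictly between [c] and 1 gives a gain that contradicts minimality at [y]. *)
have [c2 c3] := midf_lt c1.
have sy : 0 < s - enorm (y - x) by rewrite subr_gt0.
have [z /andP[zy zs] hz] := dist_ascent bA (uA yr) y0 (le_trans c0 (ltW c2)) c3 sy.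
have zx := enorm_triangle z y x.
have zs' : enorm (z - x) <= s by move: zx zs; norm_lra.
have /= := ymin z zs'.
have cz : 0 < (1 - c) * enorm (z - y) by rewrite mulr_gt0// subr_gt0.
by move: cz hz (ler_wpM2l c0 zx); norm_lra.
Qed.

(* The farthest point of the ball around [x] realises equality in the triangle
   inequality through [proj x], hence lies on the outward ray. *)
Lemma dist_ray x s : 0 < dist x -> 0 <= s -> dist x + s < r ->
  dist x + s <= dist (x + s *: outward x).
Proof.
move=> D0 s0 Ds.
have [||v /= vs||y z|y ys ymin] := @lipschitz_min _ _
    (fun y : V => - dist y) 1 (enorm x + s) [set y : V | enorm (y - x) <= s].
- move=> v hv; apply/ler_addgt0Pr => e /hv [k [/ltW kv /= ks]].
  by apply: le_trans (enorm_triangle v k x) _; rewrite addrC (enormB v) lerD.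
- by exists x; rewrite /= subrr enorm0.
- have := enorm_triangle v x 0; rewrite !subr0 => /le_trans; apply.
  by rewrite addrC lerD2l.
- exact: ler01.
- by move: (dist_lip bA z y); rewrite (enormB z y); norm_lra.
have dy : dist x + s <= dist y.
  apply/ler_addgt0Pr => e e0; have se : 0 < s + e by lra.
  (* Slope [s / (s + e)] falls short of [s] by at most [e] over length [s]. *)
  have [||z /ymin /= zy zD] := @dist_increase x s (s / (s + e)) D0 s0 Ds.
  - by rewrite divr_ge0// ltW.
  - by rewrite ltr_pdivrMr//; lra.
  have : s <= s / (s + e) * s + e.
    rewrite mulrAC -lerBlDr ler_pdivlMr//.
    by rewrite -subr_sqr -expr2 gerBl sqr_ge0.
  by move: zy zD; norm_lra.
suff -> : x + s *: outward x = y by [].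
have [Ap _] := proj_nearest bA x.
have := le_trans dy (dist_le bA y Ap).
have -> : y - proj x = (y - x) + dist x *: outward x.
  by rewrite (outwardE D0) subrKA.
have v1 := outward_sphere D0.
move=> /(sqr_homo (addr_ge0 (ltW D0) s0)).
rewrite enormD_sqr enormZ v1 (gtr0_norm D0) dotZr mulr1 => h.
(* [|y - proj x| >= dist x + s] and [|y - x| <= s] force the equality case of Cauchy-Schwarz. *)
have hs : s <= dotE (y - x) (outward x).
  rewrite -(ler_pM2l D0).
  by move: (sqr_homo (enorm_ge0 _) ys) h; norm_lra.
apply/esym/subr0_eq/enorm_eq0/eqP; rewrite eq_le enorm_ge0 andbT.
have -> : y - (x + s *: outward x) = (y - x) + - (s *: outward x) by rewrite opprD addrA.
apply: le_of_sqr => //; rewrite enormD_sqr enormN enormZ v1 mulr1 ger0_norm//.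
rewrite dotNr dotZr.
by move: (sqr_homo (enorm_ge0 _) ys) (ler_wpM2l s0 hs); norm_lra.
Qed.

End Unp_near.
End Reach.

(** * Touching balls of full radius [r] from unique projection *)

Section FullRadius.
Set Implicit Arguments.
Unset Strict Implicit.
Variables (R : realType) (d : nat) (A : set 'rV[R]_d) (r : R).
Hypothesis bA : body A.
Notation V := 'rV[R]_d.
#[local] Opaque enorm dotE proj.
Notation dist := (dist A).
Notation proj := (proj A).
Notation outward := (outward A).
Implicit Types (a b u v w x y z : V) (s t c e : R).
Hypothesis r0 : 0 < r.
Hypothesis uA : forall x, dist x < r -> Unp A x.

(** The ray estimate holds for lengths [s] below [m = r - dist x]; the Lipschitz bound extends it to
    length [m], where the ray reaches [proj x + r v]. *)
Lemma outward_NR x : 0 < dist x -> dist x < r -> NR A r (proj x) (outward x).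
Proof.
move=> D0 Dr; have v1 := outward_sphere D0.
apply/(NRE bA); split; first exact: v1.
apply/ler_addgt0Pr => e e0.
pose m := r - dist x; have m0 : 0 < m by rewrite subr_gt0.
(* The gap [m - s] is lost twice, in the length and in moving the centre; hence [e / 2]. *)
have [s [s0 sm se]] : exists s : R, [/\ 0 <= s, s < m & m <= s + e / 2].
  exists (m - Num.min m (e / 2)); split.
  - by rewrite subr_ge0 ge_min lexx.
  - by rewrite gtrBl lt_min m0 divr_gt0.
  - by rewrite -lerBlDl opprB addrC subrK ge_min lexx orbT.
have Ds : dist x + s < r by rewrite -ltrBrDl.
have := dist_ray bA uA D0 s0 Ds.
have := dist_lip bA (x + s *: outward x) (proj x + r *: outward x).
have -> : x + s *: outward x - (proj x + r *: outward x) =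
    (s - m) *: outward x.
  rewrite (_ : s - m = (s - r) + dist x); last by rewrite /m; ring.
  by rewrite scalerDl (outwardE D0) scalerBl opprD addrACA addrC.
rewrite enormZ v1 mulr1 distrC gtr0_norm ?subr_gt0//.
by move: se; rewrite /m; norm_lra.
Qed.

(** Limits of unit directions touch with radius [r] even if the approximations carry a vanishing
    slack. *)
Lemma NR_of_shrinking a v :
  (forall e, 0 < e -> exists w : V, [/\ enorm w = 1, r <= dist (a + r *: w) + e &
     enorm (w - v) < e]) -> NR A r a v.
Proof.
move=> h; apply/(NRE bA); split.
  apply: le_anti; apply/andP; split; apply/ler_addgt0Pr => e /h[w [w1 _ /ltW wv]].
    rewrite -w1; apply: le_trans (_ : enorm w + enorm (v - w) <= _).
      by rewrite -[leLHS](congr1 _ (subrK w v)) addrC enormD.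
    by rewrite lerD2l enormB.
  by rewrite -w1 -{1}(subrK v w) addrC (le_trans (enormD _ _))// lerD2l.
apply/ler_addgt0Pr => e e0; have r1 : 0 < r + 1 by rewrite addr_gt0 ?ltr01.
have [f f0 <-] : exists2 f : R, 0 < f & r * f + f = e.
  by exists (e / (r + 1)); [exact: divr_gt0 | field; rewrite gt_eqF].
have [w [_ rw /ltW wv]] := h _ f0.
have := dist_lip bA (a + r *: w) (a + r *: v).
have -> : enorm (a + r *: w - (a + r *: v)) = r * enorm (w - v).
  by rewrite opprD addrACA subrr add0r -scalerBr enormZ gtr0_norm.
by move: rw (ler_wpM2l (ltW r0) wv); norm_lra.
Qed.

(** Points outside [A] tending to [a] have projections tending to [a]; by compactness their outward
    directions accumulate. *)
Lemma boundary_NR a : boundary A a -> NR A r a !=set0.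
Proof.
move=> ba; have Aa : A a by apply: bA.2 => e /ba[].
have [e e' v ee' [v1 rv]|e e0|v hv] := @shrinking_limit _ _
    (fun e (v : V) => enorm v = 1 /\ r <= dist (a + r *: v) + e) 1.
- by split => //; apply: le_trans rv _; rewrite lerD2l.
(* [f < r] ensures [dist x < r], and [2 * f] bounds [|proj x - a|]. *)
- have [f [f0 fr fe]] : exists f : R, [/\ 0 < f, f < r & 2 * f <= e].
    exists (Num.min r e / 2); split; first by rewrite divr_gt0// lt_min r0.
      by rewrite ltr_pdivrMr// gt_min mulr_natr mulr2n ltrDl r0.
    by rewrite mulrC divfK ?pnatr_eq0// ge_min lexx orbT.
  have [_ [x [+ nAx]]] := ba _ f0; rewrite /eball /= => xa'.
  have xa : enorm (x - a) < f := xa'.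
  have D0 := dist_gt0 bA nAx.
  have Dx := dist_le bA x Aa.
  have Dr : dist x < r := le_lt_trans Dx (lt_trans xa fr).
  have v1 := outward_sphere D0.
  exists (outward x); split; last by rewrite v1.
  split => //; have [_ h] := (NRE bA _ _ _).1 (outward_NR D0 Dr).
  have := dist_lip bA (proj x + r *: outward x) (a + r *: outward x).
  have -> : proj x + r *: outward x - (a + r *: outward x) = proj x - a.
    by rewrite opprD addrACA subrr addr0.
  have := enorm_triangle (proj x) x a; rewrite (enormB (proj x) x) -(distE A x).
  by move: h Dx xa fe; norm_lra.
exists v; apply: NR_of_shrinking => e /hv[w [[w1 rw] wv]].
by exists w.
Qed.

(** Otherwise the offending directions accumulate at a tangent vector with positive product with
    [u]. *)
Lemma Nor_eventually_le a u e : Nor A a u -> 0 < e ->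
  exists2 t : R, 0 < t & forall b : V, A b -> enorm (b - a) < t ->
    dotE (b - a) u <= e * enorm (b - a).
Proof.
move=> nu e0; apply: contrapT => hno.
have [t t' v tt' [b [Ab ba bu ->]]|t t0|w hw] := @shrinking_limit _ _
    (fun t (v : V) => exists b : V, [/\ A b, enorm (b - a) < t,
       e * enorm (b - a) < dotE (b - a) u & v = (enorm (b - a))^-1 *: (b - a)]) 1.
- by exists b; split => //; exact: lt_le_trans tt'.
- have [b [Ab [ba bu]]] : exists b : V, A b /\ enorm (b - a) < t /\
      e * enorm (b - a) < dotE (b - a) u.
    apply: contrapT => hb; apply: hno; exists t => // b Ab ba.
    rewrite leNgt; apply/negP => bu; apply: hb.
    by exists b.
  exists ((enorm (b - a))^-1 *: (b - a)); split; first by exists b.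
  rewrite enormZ ger0_norm ?invr_ge0 ?enorm_ge0//.
  have [->|n0] := eqVneq (enorm (b - a)) 0; first by rewrite mulr0 ler01.
  by rewrite mulVf.
have pos b : e * enorm (b - a) < dotE (b - a) u -> 0 < enorm (b - a).
  move=> bu; apply: enorm_gt0 => ba0; move: bu.
  by rewrite ba0 enorm0 mulr0 -(scale0r (0 : V)) dotZl mul0r ltxx.
have Tw : Tan A a w.
  move=> t /hw[v [[b [Ab ba bu ->]] wv]]; exists b; split => //; split => //.
  by exists (enorm (b - a))^-1; rewrite invr_gt0 pos.
have := nu w Tw; rewrite dotC leNgt => /negP; apply.
apply: lt_le_trans (_ : e / 2 <= _); first by rewrite divr_gt0.
have u1 : 0 < enorm u + 1 by rewrite ltr_wpDl ?enorm_ge0.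
have f0 : 0 < e / (2 * (enorm u + 1)) by rewrite divr_gt0 ?mulr_gt0 ?ltr0n.
have [v [[b [Ab ba bu vE]] wv]] := hw _ f0.
have ev : e <= dotE v u.
  by rewrite vE dotZl mulrC ler_pdivlMr ?pos// ltW.
have : dotE (v - w) u <= e / 2.
  apply: le_trans (cauchy_schwarz _ _) _.
  apply: le_trans (_ : e / (2 * (enorm u + 1)) * (enorm u + 1) <= _).
    by rewrite ler_pM ?enorm_ge0 ?(ltW wv)// lerDl ler01.
  by rewrite le_eqVlt; apply/orP; left; apply/eqP; field; rewrite gt_eqF.
by rewrite dotDl dotNl; move: ev; norm_lra.
Qed.

(* The nearest point [b] of [a + t u] satisfies [|b - a| = o(t)], so the outward
   direction at [a + t u] tends to [u]. *)
Lemma Nor_NR a u : A a -> enorm u = 1 -> Nor A a u -> NR A r a u.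
Proof.
move=> Aa u1 nu; apply: NR_of_shrinking => e e0.
have r1 : 0 < 5 * (r + 1) by rewrite mulr_gt0 ?ltr0n ?addr_gt0.
(* [f <= 1/4] keeps [dist x] positive; [5 * (r + 1) * f] covers both the direction error [4 * f] and
   the centre shift [r * f]. *)
have [f [f0 f4 fe]] : exists f : R, [/\ 0 < f, f <= 4^-1 & 5 * (r + 1) * f <= e].
  exists (Num.min 4^-1 (e / (5 * (r + 1)))); split.
  - by rewrite lt_min invr_gt0 ltr0n divr_gt0.
  - by rewrite ge_min lexx.
  - by rewrite mulrC -ler_pdivlMr// ge_min lexx orbT.
have [t0 t00 ht] := Nor_eventually_le nu f0.
(* [t <= r / 2] gives [dist x < r] and [2 * t * f <= r * f]; [2 * t < t0] makes the normal estimate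
   apply to [b]. *)
have [t [tp tr tt]] : exists t : R, [/\ 0 < t, t <= r / 2 & 2 * t < t0].
  exists (Num.min (r / 2) (t0 / 4)); split.
  - by rewrite lt_min !divr_gt0.
  - by rewrite ge_min lexx.
  - rewrite -ltr_pdivlMl ?ltr0n// gt_min; apply/orP; right.
    by lra.
have [x xa] : exists x : V, x - a = t *: u.
  by exists (a + t *: u); rewrite addrAC subrr add0r.
have nxa : enorm (x - a) = t by rewrite xa enormZ u1 mulr1 gtr0_norm.
have Dt : dist x <= t by rewrite -nxa dist_le.
have Dr : dist x < r by move: Dt tr r0; norm_lra.
have [Ab _] := proj_nearest bA x; set b := proj x in Ab.
have xb : enorm (x - b) = dist x by rewrite distE.
have ba : enorm (b - a) <= 2 * t.
  have := enorm_triangle b x a; rewrite (enormB b x) xb nxa.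
  by move: Dt; norm_lra.
have bu := ht b Ab (le_lt_trans ba tt).
(* Squaring [|t u - (b - a)| <= t] gives [|b - a|^2 <= 2 t <b - a, u>], and the normal estimate
   bounds this by [2 t f |b - a|]. *)
have ba2 : enorm (b - a) <= 2 * t * f.
  have : enorm (b - a) ^+ 2 <= 2 * t * dotE (b - a) u.
    have := sqr_homo (dist_ge0 _ _) Dt; rewrite -xb.
    have -> : x - b = t *: u + - (b - a) by rewrite -xa opprB subrKA.
    rewrite (enormD_sqr (t *: u)) enormN enormZ u1 mulr1 (gtr0_norm tp) dotNr dotZl (dotC u).
    by norm_lra.
  have [->|n0] := eqVneq (enorm (b - a)) 0.
    by rewrite ?mulr_ge0 ?ler0n ?(ltW tp) ?(ltW f0).
  have p0 : 0 < enorm (b - a) by rewrite lt_neqAle eq_sym n0 enorm_ge0.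
  move=> h; rewrite -(ler_pM2r p0) -expr2; apply: le_trans h _.
  by rewrite -!mulrA ler_pM2l ?ltr0n// ler_pM2l.
have tb : t <= dist x + enorm (b - a).
  by rewrite -xb -nxa enorm_triangle.
have tf : t * f <= t / 4 by rewrite ler_wpM2l ?(ltW tp).
have D0 : 0 < dist x by move: tb ba2 tf tp; norm_lra.
have [v1 hv] := (NRE bA _ _ _).1 (outward_NR D0 Dr).
(* [t (outward x - u)] is [(t - dist x) outward x - (b - a)], both terms of length at most
   [|b - a| <= 2 t f]. *)
have uv : enorm (outward x - u) <= 4 * f.
  rewrite -(ler_pM2l tp) -[X in X * enorm _](gtr0_norm tp) -enormZ.
  have -> : t *: (outward x - u) =
      (t - dist x) *: outward x + - (b - a).
    by rewrite scalerBr scalerBl (outwardE D0) -xa -/b -addrA -opprD subrKA.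
  apply: le_trans (enormD _ _) _; rewrite enormN enormZ v1 mulr1.
  rewrite ger0_norm ?subr_ge0//.
  by move: tb ba2; norm_lra.
exists (outward x); split => //; last first.
  apply: le_lt_trans uv _; apply: lt_le_trans fe.
  by rewrite ltr_pM2r// mulrDr mulr1 ltr_pwDl ?mulr_gt0 ?ltr0n ?ler_nat.
have := dist_lip bA (proj x + r *: outward x) (a + r *: outward x).
have -> : proj x + r *: outward x - (a + r *: outward x) = b - a.
  by rewrite opprD addrACA subrr addr0.
have : t * f <= r / 2 * f by rewrite ler_wpM2r ?(ltW f0).
have : 0 < r * f by rewrite mulr_gt0.
by move: hv ba2 fe f0; rewrite -/b; norm_lra.
Qed.

End FullRadius.

(** * Reach as a uniqueness radius, and the equivalence *)

(** The supremum at [proj x] exceeds [dist A x], so some admissible ball there contains [x];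
    conversely [r] itself is admissible at each point of [A]. *)
Lemma le_reachP (R : realType) (d : nat) (r : R) (A : set 'rV[R]_d) :
  0 < r -> body A ->
  ((r%:E <= reach A)%E <-> forall x, dist A x < r -> Unp A x).
Proof.
move=> r0 bA; split=> [h x Dx|uA].
  have [Ap _] := proj_nearest bA x.
  have /ereal_sup_gt[_ [rho [_ rhoU] <-]] : ((dist A x)%:E < reach_at A (proj A x))%E.
    apply: lt_le_trans (_ : (r%:E <= _)%E); first by rewrite lte_fin.
    by apply: le_trans h _; apply: ereal_inf_lbound; exists (proj A x).
  by rewrite lte_fin distE => xrho; exact: rhoU.
apply: le_ereal_inf_tmp => _ [a Aa <-]; apply: ereal_sup_ubound.
exists r => //; split => // x xa; apply: uA.
exact: le_lt_trans (dist_le bA x Aa) xa.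
Qed.

Theorem mainTheorem7 (R : realType) (d : nat) (r : R) (A : set 'rV[R]_d) :
  (2 <= d)%N -> 0 < r -> body A ->
  ((R_supported A r /\
    (forall a, boundary A a -> Nor A a `&` sphere (d:=d) = NR A r a))
   <-> (r%:E <= reach A)%E).
Proof.
move=> _ r0 bA; rewrite le_reachP//; split=> [[_ hN] x Dx|uA].
  by apply: (Unp_of_Nor_NR bA r0) Dx => a /hN ->.
split=> [a|a ba]; first exact: boundary_NR.
have Aa : A a by apply: bA.2 => e /ba[].
apply/seteqP; split=> v; first by move=> [nv v1]; exact: Nor_NR.
by move=> nv; split; [exact: NR_Nor nv | case: nv].
Qed.
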